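(* Let $G$ be a subgroup of the additive group of rational numbers $\mathbb{Q}$ that contains the integers $\mathbb{Z}$. Then the canonical exact sequence $$E=\big(\mathbb{Z}^\sharp\xrightarrow{j}G^\sharp\xrightarrow{p}(G/\mathbb{Z})^\sharp\big)$$ is a $ws$-extension.
   Context: For an Abelian group $G$, $G^\sharp$ denotes the group $G$ equipped with the Bohr topology, i.e. the initial topology with respect to the family of all group homomorphisms $G\to\mathbb{T}$, where $\mathbb{T}=\mathbb{R}/\mathbb{Z}$ has its usual topology. Here $j$ is the inclusion and $p$ is the quotient homomorphism. An extension of topological Abelian groups is a sequence $B\xrightarrow{j}X\xrightarrow{p}A$ of continuous homomorphisms where $p$ is surjective and open and $j$ is a topological embedding with image $p^{-1}(0)$. It is a weak-split extension ($ws$-extension) if there is a continuous map $\mathbf{s}\colon A\to X$ (not necessarily a homomorphism) with $p\mathbf{s}=\mathrm{id}_A$ and $\mathbf{s}(0)=0$. *)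

(* Defs.v *)
From HB Require Import structures.
From mathcomp Require Import all_boot all_order all_algebra.
From mathcomp Require Import generic_quotient ring_quotient.
From mathcomp Require Import all_classical all_reals all_analysis.

Set Implicit Arguments.
Unset Strict Implicit.
Unset Printing Implicit Defensive.
Import Order.TTheory GRing.Theory Num.Theory.
Import numFieldNormedType.Exports.
Local Open Scope classical_set_scope.
Local Open Scope ring_scope.
Local Open Scope quotient_scope.

Definition integers (R : archiNumDomainType) : {pred R} :=
  fun x => x \is a Num.int.

Lemma integers_zmod_closed (R : archiNumDomainType) :
  zmod_closed (@integers R).
Proof.
by split=> [|x y]; [exact: rpred0 | exact: rpredB].
Qed.

HB.instance Definition _ (R : archiNumDomainType) :=
  GRing.isZmodClosed.Build R (@integers R) (@integers_zmod_closed R).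

Definition circle (R : realType) : Type :=
  quotient_topology (Quotient.quot (@integers R)).

Section circle.
Variable R : realType.

Local Notation I := (@integers R : zmodClosed R).

HB.instance Definition _ := Topological.copy (circle R)
  (quotient_topology (Quotient.quot I)).
(* [GRing.Zmodule.copy] would not do: [quotient_topology] and [Quotient.quot]
   carry different [choiceType] structures. *)
HB.instance Definition _ := GRing.isZmodule.Build (circle R)
  (@Quotient.addqA _ I) (@Quotient.addqC _ I)
  (@Quotient.add0q _ I) (@Quotient.addNq _ I).

Let pi : R -> circle R := \pi_(Quotient.quot (@integers R)).

Let piB x y : pi (x - y) = pi x - pi y.
Proof. exact: (@raddfB _ (Quotient.quot I)). Qed.

Let pi_eq x y : pi x = pi y <-> x - y \is a Num.int.
Proof.
have xyE : (x - y \is a Num.int) =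
    (x == y %[mod Quotient.quot I]) := Quotient.idealrBE I x y.
by rewrite xyE; exact: (rwP (@eqP (Quotient.quot I) _ _)).
Qed.

Let pi_open (W : set R) : open W -> open (pi @` W).
Proof.
move=> oW; rewrite /open /= /quotient_open.
rewrite (_ : _ @^-1` _ = \bigcup_n [set x | W (x + n%:~R)]).
  apply: bigcup_open => n _.
  apply: (@open_comp _ _ (fun x : R => x + n%:~R)) => // x _.
  by apply: cvgD; [exact: cvg_id | exact: cvg_cst].
rewrite predeqE => x; split=> /=.
  move=> [w Ww /pi_eq /intrP[n wx]]; exists n => //=.
  by rewrite -wx addrC subrK.
move=> [n _ Wxn]; exists (x + n%:~R) => //; apply/pi_eq.
by rewrite addrC addKr intr_int.
Qed.

Let circle_sub_continuous :
  continuous (fun x : circle R * circle R => x.1 - x.2).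
Proof.
move=> [a b] U; rewrite -[X in X -> _]/(nbhs (a - b) U) nbhsE.
move=> [V [oV Vab] VU].
have [r ar] : exists r, pi r = a by exists (repr a); exact: reprK.
have [s bs] : exists s, pi s = b by exists (repr b); exact: reprK.
have : nbhs (r - s) (pi @^-1` V).
  by apply: open_nbhs_nbhs; split=> //=; rewrite piB ar bs.
move/(@sub_continuous R (r, s)) => [[/= A B] [nA nB] AB].
exists (pi @` A^°, pi @` B^°) => /=.
  split; apply: open_nbhs_nbhs; split.
  - exact/pi_open/open_interior.
  - by exists r.
  - exact/pi_open/open_interior.
  - by exists s.
move=> [_ _] /= [[x /interior_subset Ax <-] [y /interior_subset By <-]].
by apply: VU; rewrite -piB; exact: (AB (x, y)).
Qed.

HB.instance Definition _ :=
  PreTopologicalNmodule_isTopologicalZmodule.Build (circle R)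
    circle_sub_continuous.

End circle.

(* The initial topology of a family of maps is obtained as the supremum of the
   initial topologies of its members. *)
Definition bohr (R : realType) (G : zmodType) : Type := G.

Section bohr.
Variables (R : realType) (G : zmodType).

HB.instance Definition _ := GRing.Zmodule.copy (bohr R G) G.
HB.instance Definition _ := Topological.copy (bohr R G)
  (sup_topology (fun h : {additive G -> circle R} =>
    Topological.on (initial_topology h))).

Let bohr_sub_continuous :
  continuous (fun x : bohr R G * bohr R G => x.1 - x.2).
Proof.
move=> x; apply/cvg_sup => h.
have hc : continuous (h : bohr R G -> circle R).
  move=> y U nU.
  have /cvg_sup/(_ h) : nbhs (y : bohr R G) --> (y : bohr R G) by exact: cvg_id.
  by apply; exact: (@initial_continuous _ _ h).
move=> U /=; rewrite nbhsE => -[_ [[V oV <-] /= Vx] VU].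
have : nbhs (h x.1 - h x.2) V.
  by apply: open_nbhs_nbhs; split=> //; rewrite -raddfB.
move/(@sub_continuous (circle R) (h x.1, h x.2)) => [[/= A B] [nA nB] AB].
rewrite -nbhsE; exists (h @^-1` A, h @^-1` B) => /=; first by split; exact: hc.
move=> y /= [Ay By]; apply: VU => /=; rewrite raddfB.
exact: (AB (h y.1, h y.2)).
Qed.

HB.instance Definition _ :=
  PreTopologicalNmodule_isTopologicalZmodule.Build (bohr R G)
    bohr_sub_continuous.

End bohr.

Definition topological_embedding (X Y : topologicalType) (f : X -> Y) : Prop :=
  [/\ continuous f, injective f &
      forall U : set X, open U -> open (f @` U : set (subspace (range f)))].

Record is_extension (B X A : topologicalZmodType) (j : B -> X) (p : X -> A) :
    Prop := {
  extension_inj_additive : zmod_morphism j ;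
  extension_proj_additive : zmod_morphism p ;
  extension_inj_embedding : topological_embedding j ;
  extension_inj_range : range j = p @^-1` [set 0] ;
  extension_proj_continuous : continuous p ;
  extension_proj_surjective : range p = setT ;
  extension_proj_open : forall U : set X, open U -> open (p @` U) }.

Definition is_ws_extension (B X A : topologicalZmodType)
    (j : B -> X) (p : X -> A) : Prop :=
  is_extension j p /\
  exists s : A -> X, [/\ continuous s, forall a, p (s a) = a & s 0 = 0].

Record subgroup (V : zmodType) (S : zmodClosed V) :=
  Subgroup { subgroup_val : V ; _ : subgroup_val \in S }.

HB.instance Definition _ (V : zmodType) (S : zmodClosed V) :=
  [isSub for @subgroup_val V S].
HB.instance Definition _ (V : zmodType) (S : zmodClosed V) :=
  [Choice of subgroup S by <:].
HB.instance Definition _ (V : zmodType) (S : zmodClosed V) :=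
  [SubChoice_isSubZmodule of subgroup S by <:].

Section modZ.
Variable G : zmodClosed rat.

Definition subgroup_integers : {pred subgroup G} :=
  fun x => val x \is a Num.int.

Lemma subgroup_integers_zmod_closed : zmod_closed subgroup_integers.
Proof.
split=> [|x y xi yi]; rewrite -topredE /= /subgroup_integers.
  by rewrite raddf0 rpred0.
by rewrite raddfB rpredB.
Qed.

HB.instance Definition _ := GRing.isZmodClosed.Build (subgroup G)
  subgroup_integers subgroup_integers_zmod_closed.

Definition modZ : Type := Quotient.quot subgroup_integers.
HB.instance Definition _ := GRing.Zmodule.on modZ.

Definition modZ_proj (x : subgroup G) : modZ :=
  \pi_(Quotient.quot subgroup_integers) x.

Definition int_incl (ZG : forall n : int, n%:~R \in G) (n : int) : subgroup G :=
  Subgroup (ZG n).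

End modZ.

(* Main.v *)
(* Every character of G is the sum of a map q |-> t q mod 1 and of a character
   of G / Z.  Hence a map into G with its Bohr topology is continuous as soon
   as its composites with the inclusion of G in the real line and with the
   projection to G / Z are.  Cutting the circle at an irrational point (here the
   class of pi / 4), every class of G / Z has a unique representative in
   (pi / 4 - 1, pi / 4), depending continuously on the class: this is the
   section s.  Translates of s show that the projection p is open, and the
   continuous retraction x |-> x - s (p x) of G onto Z shows that the inclusion
   of Z is an embedding. *)
Require Import Defs.
From HB Require Import structures.
From mathcomp Require Import all_boot all_order all_algebra.
From mathcomp Require Import generic_quotient ring_quotient.
From mathcomp Require Import all_classical all_reals all_analysis.
From mathcomp Require Import lra zify.
Set Implicit Arguments.
Unset Strict Implicit.
Unset Printing Implicit Defensive.
Import Order.TTheory GRing.Theory Num.Theory.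
Import numFieldNormedType.Exports.
Local Open Scope classical_set_scope.
Local Open Scope ring_scope.
Local Open Scope quotient_scope.

(** * Sums and differences of continuous maps into a topological group *)

Section topological_group.
Variables (X : topologicalType) (M : topologicalZmodType) (f g : X -> M).

Lemma topgroup_continuousD :
  continuous f -> continuous g -> continuous (fun x => f x + g x).
Proof.
move=> fc gc x; exact: (cvg_comp2 (h := +%R) (fc x) (gc x) (@add_continuous M (f x, g x))).
Qed.

Lemma topgroup_continuousB :
  continuous f -> continuous g -> continuous (fun x => f x - g x).
Proof.
move=> fc gc x; exact: (cvg_comp2 (h := fun a b : M => a - b)
  (fc x) (gc x) (@sub_continuous M (f x, g x))).
Qed.

End topological_group.

(** * The projection of the real line onto the circle *)

Section circle_projection.
Variable R : realType.

Definition circle_proj (x : R) : circle R := \pi_(Quotient.quot (@integers R)) x.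

Fact circle_proj_is_zmod_morphism : zmod_morphism circle_proj.
Proof. exact: (@raddfB _ (Quotient.quot (@integers R : zmodClosed R))). Qed.

HB.instance Definition _ := GRing.isZmodMorphism.Build R (circle R) circle_proj
  circle_proj_is_zmod_morphism.

Lemma circle_proj_eq x y :
  circle_proj x = circle_proj y <-> x - y \is a Num.int.
Proof.
have xyE : (x - y \is a Num.int) = (x == y %[mod Quotient.quot (@integers R)]) :=
  Quotient.idealrBE (@integers R : zmodClosed R) x y.
by rewrite xyE; exact: (rwP (@eqP (Quotient.quot (@integers R)) _ _)).
Qed.

Lemma circle_proj_int (n : int) : circle_proj n%:~R = 0.
Proof.
by rewrite -[RHS](raddf0 circle_proj); apply/circle_proj_eq; rewrite subr0 intr_int.
Qed.

Lemma circle_proj_surj (a : circle R) : exists x, circle_proj x = a.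
Proof. by exists (repr a); exact: reprK. Qed.

Lemma circle_proj_continuous : continuous circle_proj.
Proof. exact: (@pi_continuous _ (Quotient.quot (@integers R))). Qed.

(** The full preimage of the image of [W] is the union of the integer translates of [W], each of
    which is open. *)
Lemma circle_proj_open (W : set R) : open W -> open (circle_proj @` W).
Proof.
move=> oW; rewrite /open /= /quotient_open.
rewrite (_ : _ @^-1` _ = \bigcup_n [set x | W (x + n%:~R)]).
  apply: bigcup_open => n _.
  apply: (@open_comp _ _ (fun x : R => x + n%:~R)) => // x _.
  by apply: cvgD; [exact: cvg_id | exact: cvg_cst].
rewrite predeqE => x; split=> /=.
  move=> [w Ww /circle_proj_eq /intrP[n wx]]; exists n => //=.
  by rewrite -wx addrC subrK.
move=> [n _ Wxn]; exists (x + n%:~R) => //; apply/circle_proj_eq.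
by rewrite addrC addKr intr_int.
Qed.

End circle_projection.

(** * Continuity for Bohr topologies *)

Section bohr_continuity.
Variables (R : realType) (G : zmodType).

Lemma bohr_character_continuous (h : {additive G -> circle R}) :
  continuous (h : bohr R G -> circle R).
Proof.
move=> y U nU.
have /cvg_sup/(_ h) : nbhs (y : bohr R G) --> (y : bohr R G) by exact: cvg_id.
by apply; exact: (@initial_continuous _ _ h).
Qed.

Lemma bohr_continuous (X : topologicalType) (f : X -> bohr R G) :
  (forall h : {additive G -> circle R}, continuous (fun x => h (f x))) ->
  continuous f.
Proof.
move=> hf x; apply/cvg_sup => h.
exact: (@continuous_comp_initial _ _ _ (h : G -> circle R) f (hf h) x).
Qed.

End bohr_continuity.

Lemma bohr_additive_continuous (R : realType) (H G : zmodType)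
    (f : {additive H -> G}) :
  continuous (f : bohr R H -> bohr R G).
Proof.
apply: bohr_continuous => h.
exact: (@bohr_character_continuous R H (h \o f)).
Qed.


Lemma intr_itv_eq0 (R : numDomainType) (n : int) : -1 < (n%:~R : R) < 1 -> n = 0.
Proof. by rewrite -[-1]/((-1)%:~R) -[1]/(1%:~R) !ltr_int; lia. Qed.

(** * Characters of the integers, of [G] and of [G / Z], and the continuous section *)

Section rational_group.
Variables (R : realType) (G : zmodClosed rat).
Hypothesis ZG : forall n : int, n%:~R \in G.

Fact int_incl_is_zmod_morphism : zmod_morphism (int_incl ZG).
Proof. by move=> m n; apply: val_inj; rewrite raddfB /= rmorphB. Qed.

HB.instance Definition _ := GRing.isZmodMorphism.Build int (subgroup G)
  (int_incl ZG) int_incl_is_zmod_morphism.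

Fact modZ_proj_is_zmod_morphism : zmod_morphism (@modZ_proj G).
Proof. exact: (@raddfB _ (Quotient.quot (@subgroup_integers G))). Qed.

HB.instance Definition _ := GRing.isZmodMorphism.Build (subgroup G) (modZ G)
  (@modZ_proj G) modZ_proj_is_zmod_morphism.

Lemma modZ_proj_eq (x y : subgroup G) :
  modZ_proj x = modZ_proj y <-> val (x - y) \is a Num.int.
Proof.
have xyE : (val (x - y) \is a Num.int) =
    (x == y %[mod Quotient.quot (@subgroup_integers G)]) :=
  Quotient.idealrBE (@subgroup_integers G : zmodClosed (subgroup G)) x y.
by rewrite xyE; exact: (rwP (@eqP (Quotient.quot (@subgroup_integers G)) _ _)).
Qed.

Lemma modZ_proj_surj (a : modZ G) : exists x, modZ_proj x = a.
Proof. by exists (repr a); exact: reprK. Qed.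

Lemma range_int_incl : range (int_incl ZG) = @modZ_proj G @^-1` [set 0].
Proof.
rewrite -(raddf0 (@modZ_proj G)) predeqE => x; split=> /=.
  by move=> [n _ <-]; apply/modZ_proj_eq; rewrite subr0 intr_int.
by move=> /modZ_proj_eq; rewrite subr0 => /intrP[n xn]; exists n => //; exact: val_inj.
Qed.

Lemma int_incl_inj : injective (int_incl ZG).
Proof. by move=> m n /(congr1 val) /= /intr_inj. Qed.

(** The integers are generated by 1, so a character of [G] that vanishes at 1 vanishes on all of
    them and is constant on the classes modulo the integers. *)
Lemma modZ_character_lift (f : {additive subgroup G -> circle R}) :
  f (int_incl ZG 1) = 0 ->
  exists g : {additive modZ G -> circle R}, forall x, g (modZ_proj x) = f x.
Proof.
move=> f1.
have f_eq x y : modZ_proj x = modZ_proj y -> f x = f y.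
  move=> /modZ_proj_eq /intrP[n xyn]; apply/eqP; rewrite -subr_eq0 -raddfB.
  have -> : x - y = int_incl ZG 1 *~ n.
    by rewrite -raddfMz intz; exact: val_inj.
  by rewrite raddfMz f1 mul0rz.
pose g (a : modZ G) := f (repr a).
have gE x : g (modZ_proj x) = f x by apply: f_eq; exact: reprK.
have gB : zmod_morphism g.
  move=> a b; have [x <-] := modZ_proj_surj a; have [y <-] := modZ_proj_surj b.
  by rewrite -raddfB !gE raddfB.
pose gM := GRing.isZmodMorphism.Build (modZ G) (circle R) g gB.
pose gA : {additive modZ G -> circle R} := HB.pack g gM.
by exists gA.
Qed.

Definition line_character (t : R) (x : subgroup G) : circle R :=
  circle_proj (t * ratr (val x)).

Fact line_character_is_zmod_morphism t : zmod_morphism (line_character t).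
Proof.
by move=> x y; rewrite /line_character raddfB mulrBr raddfB.
Qed.

HB.instance Definition _ t := GRing.isZmodMorphism.Build
  (subgroup G) (circle R) (line_character t) (line_character_is_zmod_morphism t).

Lemma line_character_int t n :
  line_character t (int_incl ZG n) = circle_proj (t * n%:~R).
Proof. by rewrite /line_character /= ratr_int. Qed.

(** Any real lift [t] of the value of [h] at 1 works: [line_character t] agrees with [h] at 1, so
    their difference factors through [G / Z]. *)
Lemma character_decomposition (h : {additive subgroup G -> circle R}) :
  exists t (g : {additive modZ G -> circle R}),
    forall x, h x = line_character t x + g (modZ_proj x).
Proof.
have [t th] := circle_proj_surj (h (int_incl ZG 1)).
have [|g gE] := @modZ_character_lift (h \- line_character t).
  by rewrite /= line_character_int mulr1 th subrr.
by exists t, g => x; rewrite gE /= addrC subrK.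
Qed.

Lemma int_character_extension (h : {additive int -> circle R}) :
  exists t, forall n, h n = line_character t (int_incl ZG n).
Proof.
have [t th] := circle_proj_surj (h 1); exists t => n.
by rewrite line_character_int -[in LHS](intz n) raddfMz -th -raddfMz -mulrzr.
Qed.

(** Each character of the integers is the restriction of some [line_character t], so the Bohr
    topology of [G] already controls it along [f]. *)
Lemma continuous_to_bohr_int (X : topologicalType) (f : X -> bohr R int) :
  continuous (int_incl ZG \o f : X -> bohr R (subgroup G)) -> continuous f.
Proof.
move=> fc; apply: bohr_continuous => h.
have [t hE] := int_character_extension h.
rewrite (_ : (fun x => _) = line_character t \o (int_incl ZG \o f)).
  move=> x; apply: (continuous_comp (fc x)).
  exact: (@bohr_character_continuous R _ (line_character t)).
by apply/funext => x; exact: hE.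
Qed.

(** The real coordinate takes care of the summands [line_character t] for all [t] at once, and the
    projection takes care of the summands that come from [G / Z]. *)
Lemma continuous_to_bohr_subgroup (X : topologicalType)
    (f : X -> bohr R (subgroup G)) :
  continuous (fun x => ratr (val (f x : subgroup G)) : R) ->
  continuous (@modZ_proj G \o f : X -> bohr R (modZ G)) ->
  continuous f.
Proof.
move=> vc pc; apply: bohr_continuous => h.
have [t [g hE]] := character_decomposition h.
rewrite (_ : (fun x => _) = (fun x => line_character t (f x) + g (modZ_proj (f x)))).
  apply: topgroup_continuousD => x.
    apply: (@continuous_comp _ _ _ (fun x => t * ratr (val (f x : subgroup G)))).
      by apply: continuousM; [exact: cvg_cst | exact: vc].
    exact: circle_proj_continuous.
  apply: (continuous_comp (pc x)).
  exact: (@bohr_character_continuous R _ g).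
by apply/funext => x; exact: hE.
Qed.

(* So that cutting the circle at [pi / 4] leaves the image of [G / Z] untouched. *)
Lemma pi4_gap (q : rat) (n : int) : ratr q + n%:~R != pi / 4 :> R.
Proof.
apply/eqP => qn; apply: (@pi_irrationnal R); exists ((q + n%:~R) * 4) => //.
by rewrite rmorphM rmorphD /= ratr_int ratr_nat qn divfK // pnatr_eq0.
Qed.

Lemma pi4_section : exists s : modZ G -> subgroup G,
  forall a, modZ_proj (s a) = a /\ pi / 4 - 1 < (ratr (val (s a)) : R) < pi / 4.
Proof.
suff H a : exists x : subgroup G,
    modZ_proj x = a /\ pi / 4 - 1 < (ratr (val x) : R) < pi / 4.
  by have [s sP] := choice H; exists s.
have [x <-] := modZ_proj_surj a.
(* Subtracting this [n] brings the value of [x] into the half-open interval from [pi / 4 - 1],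
   included, to [pi / 4], excluded. *)
pose n := Num.floor (ratr (val x) - pi / 4 : R) + 1.
exists (x - int_incl ZG n); split.
  by apply/modZ_proj_eq; rewrite addrC addKr raddfN rpredN intr_int.
rewrite !raddfB /= ratr_int.
have := floor_itv (ratr (val x) - pi / 4 : R).
rewrite -/n => /andP[n1 n2].
(* The left end would mean that the value of [x] plus [- n + 1] equals [pi / 4], which irrationality
   excludes. *)
have := pi4_gap (val x) (- n + 1); rewrite rmorphD rmorphN /= neq_lt.
by rewrite /n rmorphD /= in n2 *; case/orP => ?; lra.
Qed.

Lemma continuous_section : exists s : bohr R (modZ G) -> bohr R (subgroup G),
  [/\ continuous s, forall a, modZ_proj (s a) = a & s 0 = 0].
Proof.
have [s sP] := pi4_section; exists s.
pose A := bohr R (modZ G); pose y (a : A) : R := ratr (val (s a)).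
have ps a : modZ_proj (s a) = a by have [] := sP a.
have sy a : pi / 4 - 1 < y a < pi / 4 by have [] := sP a.
split=> //; last first.
  have /modZ_proj_eq : modZ_proj (s 0) = modZ_proj 0 by rewrite ps raddf0.
  rewrite subr0 => /intrP[n sn].
  have := sy 0; rewrite /y sn ratr_int => /andP[n1 n2].
  (* From [0 < pi < 4], the interval lies inside []-1, 1[], where 0 is the only integer. *)
  have := pihalf_02 R; have := pi_gt0 R => ? /andP[_ ?].
  have n0 : n = 0 by apply: (@intr_itv_eq0 R); lra.
  by apply: val_inj; rewrite sn n0 raddf0.
(* [iota] is the map of [G / Z] into the circle induced by reduction modulo 1; it is a character,
   hence Bohr continuous. *)
have [|iota iotaE] := @modZ_character_lift (line_character 1).
  by rewrite /= line_character_int mul1r circle_proj_int.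
have iotay a : iota a = circle_proj (y a).
  by rewrite -[in LHS](ps a) iotaE /= /line_character mul1r.
(* The projection of [s] is the identity, so what remains is the continuity of the real coordinate
   [y]. *)
apply: continuous_to_bohr_subgroup; last first.
  rewrite (_ : _ \o s = id); last exact/funext.
  by move=> a; exact: cvg_id.
move=> a W; rewrite -[X in X -> _]/(nbhs (y a) W) nbhsE => -[V [oV Va] VW].
pose I := [set x : R | pi / 4 - 1 < x < pi / 4].
have oI : open (V `&` I).
  apply: openI => //; rewrite (_ : I = `]pi / 4 - 1, pi / 4[%classic).
    exact: itv_open.
  by rewrite predeqE => x; rewrite /I /= in_itv.
have ic : continuous (iota : A -> circle R).
  exact: (@bohr_character_continuous R _ iota).
(* [circle_proj] is open, and injective on [I], which has length 1. So if [iota b] comes from a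
   point of [V] inside [I], that point is [y b]. *)
have : nbhs a (iota @^-1` (@circle_proj R @` (V `&` I))).
  apply: ic; apply: open_nbhs_nbhs; split; first exact: circle_proj_open.
  by exists (y a); [split=> //; exact: sy | rewrite iotay].
apply: filterS => b [x [Vx /andP[x1 x2]]] /=; rewrite iotay => /circle_proj_eq /intrP[n xyn].
apply: VW; rewrite -/(y b) (_ : y b = x) //.
have /andP[y1 y2] := sy b.
have n0 : n = 0 by apply: (@intr_itv_eq0 R); rewrite -xyn; lra.
by apply/eqP; rewrite eq_sym -subr_eq0 xyn n0.
Qed.

End rational_group.

(** * The weak-split extension *)

Theorem proposition5p17 (R : realType) (G : zmodClosed rat)
    (ZG : forall n : int, n%:~R \in G) :
  is_ws_extension
    (int_incl ZG : bohr R int -> bohr R (subgroup G))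
    (@modZ_proj G : bohr R (subgroup G) -> bohr R (modZ G)).
Proof.
pose X := bohr R (subgroup G); pose A := bohr R (modZ G).
have [s [sc ps s0]] : exists s : A -> X,
  [/\ continuous s, forall a, modZ_proj (s a) = a & s 0 = 0].
  exact: continuous_section.
have jc : continuous (int_incl ZG : bohr R int -> X).
  exact: (@bohr_additive_continuous R _ _ (int_incl ZG)).
have pc : continuous (@modZ_proj G : X -> A).
  exact: (@bohr_additive_continuous R _ _ (@modZ_proj G)).
have j0 n : modZ_proj (int_incl ZG n) = 0.
  by have : range (int_incl ZG) (int_incl ZG n) by []; rewrite range_int_incl.
split; last by exists s.
split.
- exact: int_incl_is_zmod_morphism.
- exact: modZ_proj_is_zmod_morphism.
- split=> //; first exact: int_incl_inj.
  have [r rE] : exists r : X -> bohr R int,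
      forall x : X, int_incl ZG (r x) = x - s (modZ_proj x).
    suff H (x : X) : exists n, int_incl ZG n = x - s (modZ_proj x).
      by have [r rE] := choice H; exists r.
    suff [n _ nE] : range (int_incl ZG) (x - s (modZ_proj x)) by exists n.
    by rewrite range_int_incl /= raddfB /= ps subrr.
  have rc : continuous r.
    apply: (@continuous_to_bohr_int R G ZG).
    rewrite (_ : _ \o r = fun x : X => x - s (modZ_proj x)); last exact/funext.
    apply: topgroup_continuousB; first by move=> x; exact: cvg_id.
    by move=> x; apply: (continuous_comp (pc x)); exact: sc.
  (* The normalisation [s 0 = 0] is what makes [r] a left inverse of the inclusion. *)
  have rj n : r (int_incl ZG n) = n.
    by apply: (@int_incl_inj G ZG); rewrite rE j0 s0 subr0.
  move=> U oU; apply/open_subspaceP; exists (r @^-1` U).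
    by move/continuousP: rc; exact.
  rewrite predeqE => x; split=> /=.
    by move=> [+ [n _ nx]]; rewrite -nx rj => Un; split; exists n.
  by move=> [[n Un <-] _]; rewrite rj; split=> //; exists n.
- exact: range_int_incl.
- exact: pc.
- by rewrite predeqE => a; split=> // _; exists (s a); rewrite ?ps.
- move=> U oU; rewrite openE => _ [u Uu <-].
  (* The translate of [s] taking [modZ_proj u] to [u] pulls [U] back into its image. *)
  pose su (a : A) : X := s (a - modZ_proj u) + u.
  have suc : continuous su.
    apply: topgroup_continuousD ; last exact: cst_continuous.
    move=> a.
    apply: (@continuous_comp _ _ _ (fun a : A => a - modZ_proj u)); last exact: sc.
    by apply: topgroup_continuousB; [move=> b; exact: cvg_id | exact: cst_continuous].
  have : nbhs (modZ_proj u : A) (su @^-1` U).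
    apply: suc; apply: open_nbhs_nbhs; split=> //.
    by rewrite /su subrr s0 add0r.
  apply: filterS => a /= Ua; exists (su a) => //.
  by rewrite /su raddfD /= ps subrK.
Qed.
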